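(* Let $\mathbb F$ be a field and let $\beta,\gamma\in\mathbb F$ be such that $X^2-\gamma X-\beta$ is irreducible over $\mathbb F$ (in particular, $\beta\ne0$). Let $L=L_{16}(\beta,\gamma)$, $G=\operatorname{Aut}(L)$, and $E=\mathbb F(\theta)$, where $\theta^2=\gamma\theta+\beta$. If $\gamma\ne0$ or $\operatorname{char}\mathbb F=2$, then $\Xi(G)$ consists of all matrices $$\text{(C)}\qquad\begin{pmatrix}1&0&0\\ b-\dfrac{\gamma(a-1)}{\beta}&a&\beta b\\ \dfrac{a-1}{\beta}&b&a+\gamma b\end{pmatrix},\qquad a,b\in\mathbb F,\ (a,b)\ne(0,0),$$ and $G\cong E^{\times}$. If $\operatorname{char}\mathbb F\ne2$ and $\gamma=0$, then $\Xi(G)$ consists of the matrices of the form (C) together with all matrices $$\begin{pmatrix}-1&0&0\\ -b&a&-\beta b\\ \dfrac{1-a}{\beta}&b&-a\end{pmatrix},\qquad a,b\in\mathbb F,\ (a,b)\ne(0,0).$$ In this case $G$ is a semidirect product of $E^{\times}$ (normal) by a group of order two; the nontrivial element acts on $E$ by $a+b\theta\mapsto a-b\theta$ ($a,b\in\mathbb F$).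
   Context: A left Leibniz algebra over $\mathbb F$ is a vector space with a bilinear product satisfying $[x,[y,z]]=[[x,y],z]+[y,[x,z]]$. $L_{16}(\beta,\gamma)$ is the three-dimensional left Leibniz algebra over $\mathbb F$ with basis $a_1,a_2,a_3$ and nonzero products $[a_1,a_1]=a_2$, $[a_1,a_2]=a_3$, $[a_1,a_3]=\beta a_2+\gamma a_3$ (all other products of basis elements are zero). $\operatorname{Aut}(L)$ is the group of invertible linear maps $f:L\to L$ with $f([x,y])=[f(x),f(y)]$. $\Xi:\operatorname{Aut}(L)\to GL_3(\mathbb F)$ is the monomorphism sending $f$ to its matrix in the basis $a_1,a_2,a_3$, the $j$-th column being the coordinates of $f(a_j)$. $E^{\times}$ is the multiplicative group of the field $E$. *)

(* Defs.v *)
From HB Require Import structures.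
From mathcomp Require Import all_boot all_order all_algebra all_fingroup.
From mathcomp Require Import all_field boolp.

Set Implicit Arguments.
Unset Strict Implicit.
Unset Printing Implicit Defensive.

Import GRing.Theory.
Local Open Scope ring_scope.

HB.mixin Record Lmodule_isLeftLeibniz (F : fieldType) L of GRing.Lmodule F L := {
  lbr : L -> L -> L;
  lbr_bilinear : bilinear_for *:%R *:%R lbr;
  lbr_leibniz : forall x y z : L,
    lbr x (lbr y z) = lbr (lbr x y) z + lbr y (lbr x z)
}.

#[short(type="leftLeibnizType")]
HB.structure Definition LeftLeibniz (F : fieldType) :=
  {L of Lmodule_isLeftLeibniz F L & GRing.Lmodule F L}.

HB.instance Definition _ (F : fieldType) (L : leftLeibnizType F) :=
  bilinear_isBilinear.Build F L L L *:%R *:%R (@lbr F L) lbr_bilinear.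

Section Aut.
Variables (F : fieldType) (L : leftLeibnizType F).

Definition is_aut (f : L -> L) : Prop :=
  [/\ linear f, bijective f & forall x y, f (lbr x y) = lbr (f x) (f y)].

Definition autL := {f : L -> L | `[< is_aut f >]}.
HB.instance Definition _ := Choice.on autL.

Definition aut_fun (f : autL) : L -> L := val f.
Coercion aut_fun : autL >-> Funclass.

Lemma autP (f : autL) : is_aut f.
Proof. exact/asboolP/(valP f). Qed.

Lemma eq_aut (f g : autL) : f =1 g -> f = g.
Proof. by move=> fg; apply/val_inj/funext. Qed.

Definition Aut_of (f : L -> L) (hf : is_aut f) : autL := exist _ f (asboolT hf).

Lemma is_aut_id : is_aut id.
Proof. by split=> //; exists id. Qed.

Lemma is_aut_comp (f g : autL) : is_aut (f \o g).
Proof.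
case: (autP f) (autP g) => [lf bf mf] [lg bg mg].
split; [|exact: bij_comp|by move=> x y /=; rewrite mg mf].
by move=> a x y /=; rewrite lg lf.
Qed.

Lemma aut_inv_ex (f : autL) : exists g, cancel f g /\ cancel g f.
Proof. by case: (autP f) => _ [g fK gK] _; exists g. Qed.

Definition aut_inv_fun (f : autL) : L -> L := sval (cid (aut_inv_ex f)).

Lemma aut_funK (f : autL) : cancel f (aut_inv_fun f).
Proof. by case: (svalP (cid (aut_inv_ex f))). Qed.

Lemma aut_inv_funK (f : autL) : cancel (aut_inv_fun f) f.
Proof. by case: (svalP (cid (aut_inv_ex f))). Qed.

Lemma is_aut_inv (f : autL) : is_aut (aut_inv_fun f).
Proof.
have fK := aut_funK f; have gK := aut_inv_funK f.
case: (autP f) => lf _ mf; split.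
- by move=> a x y; apply: (can_inj fK); rewrite lf !gK.
- by exists f.
- by move=> x y; apply: (can_inj fK); rewrite mf !gK.
Qed.

Definition aut_one : autL := Aut_of is_aut_id.
Definition aut_mul (f g : autL) : autL := Aut_of (is_aut_comp f g).
Definition aut_inv (f : autL) : autL := Aut_of (is_aut_inv f).

Fact aut_mulA : associative aut_mul.
Proof. by move=> f g h; apply: eq_aut. Qed.
Fact aut_mul1 : left_id aut_one aut_mul.
Proof. by move=> f; apply: eq_aut. Qed.
Fact aut_1mul : right_id aut_one aut_mul.
Proof. by move=> f; apply: eq_aut. Qed.
Fact aut_mulV : left_inverse aut_one aut_inv aut_mul.
Proof. by move=> f; apply: eq_aut => x; exact: aut_funK. Qed.
Fact aut_Vmul : right_inverse aut_one aut_inv aut_mul.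
Proof. by move=> f; apply: eq_aut => x; exact: aut_inv_funK. Qed.

HB.instance Definition _ :=
  isGroup.Build autL aut_mulA aut_mul1 aut_1mul aut_mulV aut_Vmul.

Lemma autME (f g : autL) x : ((f * g)%g : autL) x = f (g x).
Proof. by []. Qed.

End Aut.

(* MathComp's [{unit R}] is restricted to finite rings. *)
Section Units.
Variable R : unitRingType.

Definition unitsG := {x : R | x \is a GRing.unit}.
HB.instance Definition _ := Choice.on unitsG.

Definition Unit_of (x : R) (ux : x \is a GRing.unit) : unitsG := exist _ x ux.

Fact units_mul_subproof (u v : unitsG) : val u * val v \is a GRing.unit.
Proof. by rewrite unitrMl; exact: valP. Qed.
Fact units_inv_subproof (u : unitsG) : (val u)^-1 \is a GRing.unit.
Proof. by rewrite unitrV; exact: valP. Qed.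

Definition units_one : unitsG := Unit_of (unitr1 R).
Definition units_mul (u v : unitsG) : unitsG := Unit_of (units_mul_subproof u v).
Definition units_inv (u : unitsG) : unitsG := Unit_of (units_inv_subproof u).

Fact units_mulA : associative units_mul.
Proof. by move=> u v w; apply/val_inj; exact: mulrA. Qed.
Fact units_mul1 : left_id units_one units_mul.
Proof. by move=> u; apply/val_inj; exact: mul1r. Qed.
Fact units_1mul : right_id units_one units_mul.
Proof. by move=> u; apply/val_inj; exact: mulr1. Qed.
Fact units_mulV : left_inverse units_one units_inv units_mul.
Proof. by move=> u; apply/val_inj; apply: mulVr; exact: valP. Qed.
Fact units_Vmul : right_inverse units_one units_inv units_mul.
Proof. by move=> u; apply/val_inj; apply: mulrV; exact: valP. Qed.

HB.instance Definition _ :=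
  isGroup.Build unitsG units_mulA units_mul1 units_1mul units_mulV units_Vmul.

End Units.

Definition group_isom (G H : groupType) : Prop :=
  exists f : {multiplicative G -> H}, bijective f.

(* [G] is the internal semidirect product of a normal copy [i(N)] of [N] by a
   copy [j(H)] of [H], and conjugation by [j h] induces [act h] on [N].
   Conjugation is written out because MathComp's [x ^ y] is [y^-1 * x * y]. *)
Record is_semidirect (G N H : groupType) (act : H -> N -> N)
    (i : {multiplicative N -> G}) (j : {multiplicative H -> G}) : Prop := {
  sd_injl : injective i;
  sd_injr : injective j;
  sd_normal : forall (g : G) (n : N), exists m : N, (g * i n * g^-1)%g = i m;
  sd_trivI : forall (n : N) (h : H), i n = j h -> i n = 1%g;
  sd_prod : forall g : G, exists n : N, exists h : H, g = (i n * j h)%g;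
  sd_act : forall (h : H) (n : N), (j h * i n * (j h)^-1)%g = i (act h n)
}.

Definition semidirect (G N H : groupType) (act : H -> N -> N) : Prop :=
  exists (i : {multiplicative N -> G}) (j : {multiplicative H -> G}),
    is_semidirect act i j.

(* Indices are shifted: [a_ 0], [a_ 1], [a_ 2] are a1, a2, a3. *)
Definition L16 (F : fieldType) (beta gamma : F) : Type := 'cV[F]_3.

Section L16.
Variables (F : fieldType) (beta gamma : F).

HB.instance Definition _ := GRing.Lmodule.copy (L16 beta gamma) 'cV[F]_3.

Definition a_ (k : 'I_3) : L16 beta gamma := delta_mx k 0.

Definition L16_coord (x : L16 beta gamma) (k : 'I_3) : F := (x : 'cV[F]_3) k 0.

Definition L16_table (k l : 'I_3) : L16 beta gamma :=
  if k == 0 then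
    if l == 0 then a_ 1
    else if l == 1 then a_ 2
    else beta *: a_ 1 + gamma *: a_ 2
  else 0.

Definition L16_br (x y : L16 beta gamma) : L16 beta gamma :=
  \sum_(k < 3) \sum_(l < 3) (L16_coord x k * L16_coord y l) *: L16_table k l.

Fact L16_br_bilinear : bilinear_for *:%R *:%R L16_br.
Proof.
split=> u c x y; rewrite /= /L16_br scaler_sumr -big_split; apply: eq_bigr => k _;
  rewrite scaler_sumr -big_split; apply: eq_bigr => l _ /=;
  rewrite scalerA -scalerDl; congr (_ *: _); rewrite /L16_coord !mxE.
- by rewrite mulrDl mulrA.
- by rewrite mulrDr mulrCA.
Qed.

Lemma L16_brE (x y : L16 beta gamma) :
  L16_br x y = L16_coord x 0 *: \sum_(l < 3) L16_coord y l *: L16_table 0 l.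
Proof.
rewrite /L16_br (bigD1 0) //= [X in _ + X]big1 => [|k k0].
  by rewrite addr0 scaler_sumr; apply: eq_bigr => l _; rewrite scalerA.
by apply: big1 => l _; rewrite /L16_table (negPf k0) scaler0.
Qed.

Lemma L16_br_coord0 (x y : L16 beta gamma) : L16_coord (L16_br x y) 0 = 0.
Proof.
have tab0 l : (L16_table 0 l : 'cV[F]_3) 0 0 = 0.
  rewrite /L16_table /=; case: ifP => _; [|case: ifP => _]; rewrite !mxE //=.
  by rewrite !mulr0 addr0.
rewrite L16_brE /L16_coord mxE summxE big1 ?mulr0 // => l _.
by rewrite mxE tab0 mulr0.
Qed.

Fact L16_br_leibniz (x y z : L16 beta gamma) :
  L16_br x (L16_br y z) = L16_br (L16_br x y) z + L16_br y (L16_br x z).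
Proof.
rewrite [L16_br (L16_br x y) z]L16_brE L16_br_coord0 scale0r add0r.
pose D (w : L16 beta gamma) := \sum_(l < 3) L16_coord w l *: L16_table 0 l.
have DZ c w : D (c *: w) = c *: D w.
  rewrite /D scaler_sumr; apply: eq_bigr => l _.
  by rewrite /L16_coord mxE scalerA.
rewrite !L16_brE -/(D z) -/(D (L16_coord y 0 *: D z)).
by rewrite -/(D (L16_coord x 0 *: D z)) !DZ !scalerA mulrC.
Qed.

HB.instance Definition _ :=
  Lmodule_isLeftLeibniz.Build F (L16 beta gamma) L16_br_bilinear L16_br_leibniz.

Definition Xi_mx (f : autL (L16 beta gamma)) : 'M[F]_3 :=
  \matrix_(k, l) L16_coord (f (a_ l)) k.

Lemma Xi_mxE (f : autL (L16 beta gamma)) (x : L16 beta gamma) :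
  Xi_mx f *m (x : 'cV[F]_3) = f x.
Proof.
have [lf _ _] := autP f.
pose Hf := GRing.isLinear.Build F _ _ _ _ lf.
pose g : {linear L16 beta gamma -> L16 beta gamma} := HB.pack (f : _ -> _) Hf.
have Ex : x = \sum_(l < 3) L16_coord x l *: a_ l :> L16 beta gamma.
  apply/matrixP=> k l; rewrite !ord1 /L16_coord summxE (bigD1 k) //= !mxE eqxx.
  rewrite mulr1 big1 ?addr0 // => m mk.
  by rewrite !mxE eq_sym (negPf mk) mulr0.
transitivity (g x) => //.
rewrite [in RHS]Ex linear_sum; apply/matrixP=> k l.
rewrite !ord1 mxE summxE; apply: eq_bigr => m _.
by rewrite linearZ !mxE mulrC.
Qed.

Lemma Xi_mxM (f g : autL (L16 beta gamma)) :
  Xi_mx (f * g)%g = Xi_mx f *m Xi_mx g.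
Proof.
apply/matrixP=> k l; rewrite [LHS]mxE autME /L16_coord -Xi_mxE !mxE.
apply: eq_bigr => m _; congr (_ * _).
by rewrite /L16_coord [RHS]mxE.
Qed.

Lemma Xi_mx1 : Xi_mx 1%g = 1%:M.
Proof. by apply/matrixP=> k l; rewrite mxE /L16_coord /= !mxE andbT. Qed.

Fact Xi_unit (f : autL (L16 beta gamma)) : Xi_mx f \is a GRing.unit.
Proof.
apply/unitrP; exists (Xi_mx f^-1%g).
by split; rewrite -[_ * _]/(_ *m _) -Xi_mxM ?mulVg ?mulgV Xi_mx1.
Qed.

Definition Xi (f : autL (L16 beta gamma)) : unitsG 'M[F]_3 :=
  Unit_of (Xi_unit f).

Fact XiM : {morph Xi : f g / (f * g)%g}.
Proof. by move=> f g; apply/val_inj; exact: Xi_mxM. Qed.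

HB.instance Definition _ := isMultiplicative.Build _ _ Xi XiM.

Lemma Xi_inj : injective Xi.
Proof.
move=> f g /(congr1 val) /= fg; apply: eq_aut => x.
by rewrite -!Xi_mxE fg.
Qed.

End L16.

Definition mx3 (F : fieldType) (rows : seq (seq F)) : 'M[F]_3 :=
  \matrix_(k, l) nth 0 (nth [::] rows k) l.

Definition matC (F : fieldType) (beta gamma a b : F) : 'M[F]_3 :=
  mx3 [:: [:: 1                            ; 0 ; 0             ];
          [:: b - gamma * (a - 1) / beta   ; a ; beta * b      ];
          [:: (a - 1) / beta               ; b ; a + gamma * b ]].

Definition matC' (F : fieldType) (beta a b : F) : 'M[F]_3 :=
  mx3 [:: [:: - 1              ; 0 ; 0            ];
          [:: - b              ; a ; - (beta * b) ];
          [:: (1 - a) / beta   ; b ; - a          ]].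

(* Main.v *)
(* The ideal spanned by [a2] and [a3] is identified with [E] via [a2 = 1] and
   [a3 = theta], so that left multiplication by [a1] becomes multiplication by
   [theta].  An automorphism [f] is determined by [f a1], because [a1] generates
   the algebra; write [c] for the first coordinate of [f a1], and
   [u = a + b theta] for [f a2].  Applying [f] to the relation expressing
   [[a1, a3]] gives [c = 1], or [c = -1] and [gamma = 0].  In the first case [f]
   acts on [E] as multiplication by [u]; in the second as conjugation followed
   by multiplication by [u]. *)

Require Import Defs.
From HB Require Import structures.
From mathcomp Require Import all_boot all_order all_algebra all_fingroup.
From mathcomp Require Import all_field boolp ring.

Set Implicit Arguments.
Unset Strict Implicit.
Unset Printing Implicit Defensive.

Import GRing.Theory.
Local Open Scope ring_scope.

(** * Indices below three and roots of irreducible quadratics *)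

Lemma ord3P (P : 'I_3 -> Prop) : P 0 -> P 1 -> P 2%:R -> forall k, P k.
Proof.
move=> P0 P1 P2 [[|[|[|//]]] k3].
- by congr (P _): P0; exact: val_inj.
- by congr (P _): P1; exact: val_inj.
- by congr (P _): P2; exact: val_inj.
Qed.

(** A root [x] would make ['X - x%:P], of size 2, a divisor associated to [p], of size 3. *)
Lemma irreducible_size3_noroot (F : fieldType) (p : {poly F}) (x : F) :
  irreducible_poly p -> size p = 3 -> ~~ root p x.
Proof.
move=> [_ irr_p] szp; apply/negP => px.
have := irr_p ('X - x%:P); rewrite size_XsubC => /(_ isT).
by rewrite dvdp_XsubCl => /(_ px)/eqp_size; rewrite szp size_XsubC.
Qed.

(** * Anisotropy of the norm form *)

Section Norm.
Variables (F : fieldType) (beta gamma : F).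
Hypothesis irr : irreducible_poly ('X^2 - gamma *: 'X - beta%:P).

Lemma size_quad : size ('X^2 - gamma *: 'X - beta%:P) = 3.
Proof.
rewrite -addrA size_polyDl size_polyXn // -opprD size_polyN ltnS.
by rewrite -mul_polyC size_MXaddC; case: ifP => // _; exact: size_polyC_leq1.
Qed.

(* The left-hand side is the norm of [a + b theta]. *)
Lemma norm_eq0 (a b : F) :
  a ^+ 2 + gamma * a * b - beta * b ^+ 2 = 0 -> (a, b) = (0, 0).
Proof.
have [->|b0 N0] := eqVneq b 0.
  by rewrite expr0n mulr0 mulr0 subr0 addr0 => /eqP; rewrite sqrf_eq0 => /eqP->.
(* For [b != 0], the value of the quadratic at [- a / b] is the norm divided by [b ^+ 2]. *)
have /negP[] := irreducible_size3_noroot (- a / b) irr size_quad.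
rewrite /root !hornerE /=; apply/eqP.
transitivity ((a ^+ 2 + gamma * a * b - beta * b ^+ 2) / b ^+ 2); first by field.
by rewrite N0 mul0r.
Qed.

Lemma irr_beta_neq0 : beta != 0.
Proof.
(* The norm of theta is [- beta]. *)
apply/eqP => b0; have := @norm_eq0 0 1.
by rewrite b0 mulr0 !mul0r expr0n addr0 subr0 => /(_ erefl)[/eqP]; rewrite oner_eq0.
Qed.

End Norm.

(** * The matrices of the automorphisms *)

Section Automorphisms.
Variables (F : fieldType) (beta gamma : F).
Hypothesis irr : irreducible_poly ('X^2 - gamma *: 'X - beta%:P).
Local Notation L := (L16 beta gamma).
Local Notation C := (matC beta gamma).
Local Notation C' := (matC' beta).

Let beta0 : beta != 0 := irr_beta_neq0 irr.

Lemma mulmx3E n (A : 'M[F]_(n, 3)) (x : 'cV_3) k :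
  (A *m x) k 0 = A k 0 * x 0 0 + A k 1 * x 1 0 + A k 2 * x 2 0.
Proof.
rewrite mxE !big_ord_recl big_ord0 addr0 addrA.
rewrite (_ : lift _ (lift _ _) = 2); last exact: val_inj.
by rewrite (_ : lift _ _ = 1) //; exact: val_inj.
Qed.

(** Only the first coordinate of [x] enters, because [a_ 1] and [a_ 2] annihilate everything from
    the left. *)
Lemma lbrE (x y : L) (k : 'I_3) : (lbr x y : 'cV_3) k 0 =
  nth 0 [:: 0; x 0 0 * (y 0 0 + beta * y 2 0);
               x 0 0 * (y 1 0 + gamma * y 2 0)] k.
Proof.
rewrite [lbr x y]L16_brE mxE summxE !big_ord_recl big_ord0.
rewrite (_ : lift _ (lift _ _) = 2); last exact: val_inj.
rewrite (_ : lift _ _ = 1); last exact: val_inj.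
by move: k; apply: ord3P; rewrite /= !mxE /L16_coord /=; ring.
Qed.

(** The parameters multiply as a + b theta and c + d theta do in E; this is the source of the
    embedding of the units. *)
Lemma matC_mul (a b c d : F) :
  C a b *m C c d = C (a * c + beta * b * d) (a * d + b * c + gamma * b * d).
Proof.
apply/matrixP; apply: ord3P; apply: ord3P;
  by rewrite !mxE !big_ord_recl big_ord0 !mxE /=; field.
Qed.

Lemma matC10 : C 1 0 = 1%:M.
Proof. by apply/matrixP; apply: ord3P; apply: ord3P; rewrite !mxE /=; field. Qed.

Lemma matC_unit (a b : F) : (a, b) != (0, 0) -> C a b \in unitmx.
Proof.
move=> ab0; pose N := a ^+ 2 + gamma * a * b - beta * b ^+ 2.
have N0 : N != 0 by apply: contraNneq ab0 => /(norm_eq0 irr)->.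
(* The parameters are those of the inverse of a + b theta: its conjugate (a + gamma b) - b theta
   divided by the norm. *)
have : C a b *m C ((a + gamma * b) / N) (- b / N) = 1%:M.
  by rewrite -matC10 matC_mul; congr C; rewrite /N; field.
by case/mulmx1_unit.
Qed.

(** [C' 1 0] is the diagonal matrix with entries -1, 1, -1. On the ideal identified with E it is the
    conjugation theta -> - theta, so the second family is a coset of the first. *)
Lemma matC'_mul (a b : F) : gamma = 0 -> C' a b = C a b *m C' 1 0.
Proof.
move=> g0; apply/matrixP; apply: ord3P; apply: ord3P;
  by rewrite !mxE !big_ord_recl big_ord0 !mxE /= ?g0; field.
Qed.

Lemma matC'10_sqr : C' 1 0 *m C' 1 0 = 1%:M.
Proof.
apply/matrixP; apply: ord3P; apply: ord3P;
  by rewrite !mxE !big_ord_recl big_ord0 !mxE /=; field.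
Qed.

Lemma matC'10_conj (a b : F) : gamma = 0 ->
  C' 1 0 *m C a b *m C' 1 0 = C a (- b).
Proof.
move=> g0; apply/matrixP; apply: ord3P; apply: ord3P;
  by rewrite !mxE !big_ord_recl big_ord0 !mxE /=
     !big_ord_recl !big_ord0 !mxE /= ?g0; field.
Qed.

Lemma matC_inj (a b c d : F) : C a b = C c d -> (a, b) = (c, d).
Proof.
by move=> /matrixP E; have := E 1 1; have := E 2 1; rewrite !mxE /= => -> ->.
Qed.

Lemma mx_aut (M : 'M[F]_3) : M \in unitmx ->
  (forall x y : L, M *m (lbr x y : L) = lbr (M *m x : L) (M *m y : L) :> 'cV_3) ->
  exists f : autL L, val (Xi f) = M.
Proof.
move=> uM mM.
have autM : is_aut ((fun x => M *m x) : L -> L).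
  split=> //; first by move=> c x y; rewrite mulmxDr -scalemxAr.
  by exists (fun x : L => invmx M *m x : L) => x; rewrite ?mulKmx ?mulKVmx.
exists (Aut_of autM); apply/matrixP => k l; have /matrixP/(_ k 0) := colE l M.
by rewrite [X in X = _ -> _]mxE => ->; rewrite mxE.
Qed.

Lemma matC_aut (a b : F) : (a, b) != (0, 0) ->
  exists f : autL L, val (Xi f) = C a b.
Proof.
move=> ab0; apply: mx_aut => [|x y]; first exact: matC_unit.
apply/matrixP=> k l; rewrite ord1 {l}; move: k; apply: ord3P;
  by rewrite !(mulmx3E, lbrE) /= ?mulmx3E !mxE /=; field.
Qed.

(** Signs disappear in characteristic 2, so the second family adds nothing there. *)
Lemma matC'_char2 (a b : F) :
  gamma = 0 -> 2%N \in [pchar F] -> C' a b = C a b.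
Proof.
move=> g0 F2; apply/matrixP; apply: ord3P; apply: ord3P;
  by rewrite !mxE /= ?(oppr_pchar2 F2) ?g0 ?mul0r ?subr0 ?addr0 // addrC.
Qed.

Lemma matC'_aut (a b : F) : gamma = 0 -> (a, b) != (0, 0) ->
  exists f : autL L, val (Xi f) = C' a b.
Proof.
move=> g0 ab0; apply: mx_aut => [|x y].
  rewrite matC'_mul // unitmx_mul matC_unit //=.
  by case/mulmx1_unit: matC'10_sqr.
apply/matrixP=> k l; rewrite ord1 {l}; move: k; apply: ord3P;
  by rewrite !(mulmx3E, lbrE) /= ?mulmx3E !mxE /= ?g0; field.
Qed.

Lemma aut_mx (f : autL L) : exists a b : F, (a, b) != (0, 0) /\
  (val (Xi f) = C a b \/ gamma = 0 /\ val (Xi f) = C' a b).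
Proof.
have [_ _ mf] := autP f; have := valP (Xi f).
have Mmul (i j : 'I_3) k :
    (val (Xi f) *m (lbr (a_ beta gamma i) (a_ beta gamma j) : L)) k 0 =
    let M := val (Xi f) in
    nth 0 [:: 0; M 0 i * (M 0 j + beta * M 2 j); M 0 i * (M 1 j + gamma * M 2 j)] k.
  by rewrite Xi_mxE mf lbrE /= !mxE.
move: (val (Xi f)) Mmul => M Mmul /= uM.
(* The images of [[a1, a1] = a2] and [[a1, a2] = a3] express the second and third columns through
   the preceding ones; [E1] and [E2] come from [[a1, a3]]. *)
have M01 := Mmul 0 0 0; have M11 := Mmul 0 0 1; have M21 := Mmul 0 0 2.
have M02 := Mmul 0 1 0; have M12 := Mmul 0 1 1; have M22 := Mmul 0 1 2.
have E1 := Mmul 0 2 1; have E2 := Mmul 0 2 2.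
move: M01 M11 M21 M02 M12 M22 E1 E2; rewrite !(mulmx3E, lbrE) /= !mxE /=.
rewrite !(mul0r, mul1r, mulr0, mulr1, addr0, add0r) => M01 M11 M21 M02.
rewrite M01 M02 !add0r => M12 M22; rewrite M12 M22 => E1 E2.
set c := M 0 0 in M11 M21 M12 M22 E1 E2 *.
set a := M 1 1 in M11 M22 E1 E2 *; set b := M 2 1 in M21 M12 M22 E1 E2 *.
(* Otherwise the second column of the invertible matrix [M] would vanish. *)
have ab0 : (a, b) != (0, 0).
  apply: contraTneq uM => -[a0 b0]; apply/negP => uM.
  suff /eqP : delta_mx 1 0 = 0 :> 'cV[F]_3.
    by move/eqP/matrixP/(_ 1 0)/eqP; rewrite !mxE /= oner_eq0.
  rewrite -[LHS](mulKmx uM) (_ : M *m _ = 0) ?mulmx0 //.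
  by apply/matrixP=> k l; rewrite ord1 -colE !mxE; move: k; apply: ord3P.
exists a, b; split=> //.
have N0 : a ^+ 2 + gamma * a * b - beta * b ^+ 2 != 0.
  by apply: contraNneq ab0 => /(norm_eq0 irr)->.
(* For [c = 1], the equations [M11] and [M21] are solved for the two unknown entries of the first
   column. *)
have [c1|c1] := eqVneq c 1.
  left; apply/matrixP; apply: ord3P; apply: ord3P;
    rewrite !mxE /= ?M01 ?M02 ?M12 ?M22 -/c -/a -/b ?c1 ?mul1r //.
    by rewrite M11 M21 c1; field.
  by rewrite M11 c1; field.
(* Up to the factor [1 - c], the equations for [f [a1, a3]] are a linear system
   in [1 + c] and [gamma * c] whose determinant is the norm of [a + b theta]. *)
have X1 : (1 - c) * (a * (1 + c) + b * (gamma * c)) = 0.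
  apply: (mulfI beta0); rewrite mulr0.
  transitivity (a * beta + c * (beta * b) * gamma - c * (beta * (c * (a + gamma * b)))).
    by ring.
  by apply/eqP; rewrite subr_eq0 E1.
have X2 : (1 - c) * (beta * b * (1 + c) + (a + gamma * b) * (gamma * c)) = 0.
  transitivity (b * beta + c * (a + gamma * b) * gamma
     - c * (c * (beta * b) + gamma * (c * (a + gamma * b)))).
    by ring.
  by apply/eqP; rewrite subr_eq0 E2.
have c1' : 1 - c != 0 by rewrite subr_eq0 eq_sym.
move: X1 X2 => /(canRL (mulKf c1')) X1 /(canRL (mulKf c1')) X2.
rewrite mulr0 in X1 X2.
(* Cramer's rule: eliminating [gamma * c] leaves the norm times [1 + c]; below, eliminating [1 + c]
   leaves the norm times [gamma * c]. *)
have cN1 : c = -1.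
  apply/eqP; rewrite -addr_eq0 addrC; apply/eqP; apply: (mulfI N0); rewrite mulr0.
  transitivity ((a + gamma * b) * (a * (1 + c) + b * (gamma * c))
    - b * (beta * b * (1 + c) + (a + gamma * b) * (gamma * c))); first by ring.
  by rewrite X1 X2 !mulr0 subr0.
have g0 : gamma = 0.
  apply: (mulfI N0); rewrite mulr0; apply/eqP; rewrite -oppr_eq0; apply/eqP.
  transitivity (a * (beta * b * (1 + c) + (a + gamma * b) * (gamma * c))
    - beta * b * (a * (1 + c) + b * (gamma * c))); first by rewrite cN1; ring.
  by rewrite X1 X2 !mulr0 subr0.
right; split=> //; apply/matrixP; apply: ord3P; apply: ord3P;
  rewrite !mxE /= ?M01 ?M02 ?M12 ?M22 -/c -/a -/b //.
- by rewrite M21 cN1 g0; ring.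
- by rewrite cN1; ring.
- by rewrite M11 cN1; field.
- by rewrite cN1 g0; ring.
Qed.

End Automorphisms.

(** * Arithmetic of [E] and the embedding of its unit group *)

Section QuadraticExtension.
Variables (F : fieldType) (beta gamma : F).
Hypothesis irr : irreducible_poly ('X^2 - gamma *: 'X - beta%:P).
Variables (E : fieldExtType F) (theta : E).
Hypothesis Egen : <<1; theta>>%VS = {:E}%VS.
Hypothesis thetaE : theta ^+ 2 = gamma *: theta + beta%:A.
Local Notation G := (autL (L16 beta gamma)).
Local Notation "a +theta b" := (a%:A + b *: theta : E) (at level 50).

Lemma quadM (a b c d : F) : (a +theta b) * (c +theta d) =
  (a * c + beta * b * d) +theta (a * d + b * c + gamma * b * d).
Proof.
(* Scaling becomes multiplication by constants of [E], so that [ring] can use the relation for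
   [theta]. *)
have algM k l : (k * l)%:A = k%:A * l%:A :> E by rewrite mulr_algl scalerA.
have sE k : k *: theta = k%:A * theta by rewrite mulr_algl.
move: thetaE; rewrite !sE !scalerDl !algM.
move: (a%:A) (b%:A) (c%:A) (d%:A) (beta%:A) (gamma%:A) => a' b' c' d' be ga tE.
by ring: tE.
Qed.

Lemma quad_eq0 (a b : F) : a +theta b = 0 -> (a, b) = (0, 0).
Proof.
move=> ab0; apply: (norm_eq0 irr); apply/eqP.
(* The second factor is the conjugate of the first: the product is the norm, and its [theta] part
   cancels. *)
have := quadM a b (a + gamma * b) (- b); rewrite ab0 mul0r.
rewrite (_ : a * - b + _ + _ = 0); last by ring.
rewrite scale0r addr0 => /esym/eqP; rewrite scaler_eq0 oner_eq0 orbF.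
by congr (_ == 0); ring.
Qed.

Lemma quad_inj (a b c d : F) : a +theta b = c +theta d -> (a, b) = (c, d).
Proof.
move=> /eqP; rewrite -subr_eq0 opprD addrACA -!scalerBl => /eqP/quad_eq0.
by case=> /eqP + /eqP; rewrite !subr_eq0 => /eqP-> /eqP->.
Qed.

(** Elements of [E] are polynomials in [theta], and the form a + b theta survives sums and
    multiplication by [theta]. *)
Lemma quad_ex (e : E) : exists ab : F * F, e = ab.1 +theta ab.2.
Proof.
have: e \in <<1; theta>>%VS by rewrite Egen memvf.
case/Fadjoin_polyP => p /polyOverP p1 ->; rewrite horner_coef.
elim/big_ind: _ => [|_ _ [[a b] ->] [[c d] ->]|i _].
- by exists (0, 0); rewrite /= !scale0r addr0.
- by exists (a + c, b + d); rewrite /= !scalerDl addrACA.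
have /vlineP[k ->] := p1 i.
elim: (nat_of_ord i) => [|n [[a b] IH]].
  by exists (k, 0); rewrite /= expr0 mulr1 scale0r addr0.
rewrite exprSr mulrA IH /=.
have := quadM a b 0 1; rewrite scale0r add0r scale1r => ->.
by exists (a * 0 + beta * b * 1, a * 1 + b * 0 + gamma * b * 1).
Qed.

Lemma quad_unit (a b : F) :
  (a, b) != (0, 0) -> a +theta b \is a GRing.unit.
Proof. by move=> ab0; rewrite unitfE; apply: contraNneq ab0 => /quad_eq0->. Qed.

Lemma quad_conj_ex :
  {sigma : E -> E | forall a b : F, sigma (a +theta b) = a%:A - b *: theta}.
Proof.
exists (fun e => let ab := sval (cid (quad_ex e)) in ab.1%:A - ab.2 *: theta).
by move=> a b /=; case: cid => -[c d] /= /quad_inj[-> ->].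
Qed.

(** [Xi] is injective, so the morphism law can be checked on matrices, where [matC_mul] mirrors
    [quadM]. *)
Lemma unit_aut_ex : exists i : {multiplicative unitsG E -> G},
  forall (u : unitsG E) (a b : F), val u = a +theta b ->
    val (Xi (i u)) = matC beta gamma a b.
Proof.
have i_ex (u : unitsG E) : exists f : G, forall a b : F, val u = a +theta b ->
    val (Xi f) = matC beta gamma a b.
  have [[a b] /= uE] := quad_ex (val u).
  have [|f fE] := matC_aut irr (a := a) (b := b).
    apply: contraTneq (valP u) => -[a0 b0].
    by rewrite /= uE a0 b0 !scale0r addr0 unitr0.
  by exists f => c d; rewrite /= uE => /quad_inj[<- <-].
pose i u := sval (cid (i_ex u)).
have iE u : forall a b : F, val u = a +theta b -> val (Xi (i u)) = matC beta gamma a b.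
  by rewrite /i; case: cid.
have iM : {morph i : u v / (u * v)%g}.
  move=> u v; apply/Xi_inj/val_inj; rewrite XiM /=.
  have [[a b] /= uE] := quad_ex (val u); have [[c d] /= vE] := quad_ex (val v).
  have uvE : val (u * v)%g =
      (a * c + beta * b * d) +theta (a * d + b * c + gamma * b * d).
    by rewrite -quadM -uE -vE.
  have:= iE _ _ _ uvE; rewrite -(matC_mul irr) -(iE _ _ _ uE) -(iE _ _ _ vE).
  by move=> /= ->.
pose iX := isMultiplicative.Build _ _ i iM.
pose iG : {multiplicative unitsG E -> G} := HB.pack i iX.
by exists iG.
Qed.

End QuadraticExtension.

(** * Morphisms of groups *)

Lemma group_morph1 (G H : groupType) (f : {multiplicative G -> H}) :
  f 1%g = 1%g.
Proof. by apply: (mulgI (f 1%g)); rewrite -gmulfM !mulg1. Qed.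

Lemma group_morphV (G H : groupType) (f : {multiplicative G -> H}) (x : G) :
  f x^-1%g = (f x)^-1%g.
Proof. by apply: (mulgI (f x)); rewrite -gmulfM !mulgV group_morph1. Qed.

(** The direction is reversed because the available map goes from the units of [E] to the
    automorphisms. *)
Lemma bijective_group_isom (G H : groupType) (f : {multiplicative G -> H}) :
  bijective f -> group_isom H G.
Proof.
move=> [g fK gK]; have gM : {morph g : x y / (x * y)%g}.
  by move=> x y; apply: (can_inj fK); rewrite gmulfM !gK.
pose gX := isMultiplicative.Build _ _ g gM.
pose gG : {multiplicative H -> G} := HB.pack g gX.
by exists gG; exists f.
Qed.

Lemma inj_surj_bij (A B : Type) (f : A -> B) :
  injective f -> (forall y, exists x, y = f x) -> bijective f.
Proof.
move=> f_inj f_surj; pose g y := sval (cid (f_surj y)).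
have gK : cancel g f by move=> y; rewrite /g; case: cid.
by exists g => // x; apply: f_inj; rewrite gK.
Qed.

(** The group of order two is ['I_2] under addition modulo 2; only 1 + 1 = 0 needs the hypothesis on
    [s]. *)
Lemma involution_morph (G : groupType) (s : G) : (s * s = 1)%g ->
  exists j : {multiplicative 'I_2 -> G}, forall h, j h = if h == 0 then 1%g else s.
Proof.
move=> ss1; pose j (h : 'I_2) := if h == 0 then 1%g else s.
have jM : {morph j : x y / (x * y)%g}.
  by case=> [[|[|//]] ?] [[|[|//]] ?]; rewrite /j /= ?mulg1 ?mul1g ?ss1.
pose jX := isMultiplicative.Build _ _ j jM.
pose jG : {multiplicative 'I_2 -> G} := HB.pack j jX.
by exists jG.
Qed.

(** * Image of [Xi] and structure of [G] in the two cases *)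

Theorem theorem5p2 (F : fieldType) (beta gamma : F)
    (irr : irreducible_poly ('X^2 - gamma *: 'X - beta%:P))
    (E : fieldExtType F) (theta : E)
    (Egen : <<1; theta>>%VS = {:E}%VS)
    (thetaE : theta ^+ 2 = gamma *: theta + beta%:A) :
  let G := autL (L16 beta gamma) in
  (gamma != 0 \/ 2%N \in [pchar F] ->
     (forall M : 'M[F]_3,
        (exists f : G, M = val (Xi f)) <->
        (exists a b : F, (a, b) != (0, 0) /\ M = matC beta gamma a b))
     /\ group_isom G (unitsG E))
  /\
  (2%N \notin [pchar F] -> gamma = 0 ->
     (forall M : 'M[F]_3,
        (exists f : G, M = val (Xi f)) <->
        (exists a b : F, (a, b) != (0, 0) /\
           (M = matC beta gamma a b \/ M = matC' beta a b)))
     /\ exists (H : finGroupType) (act : H -> unitsG E -> unitsG E)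
               (sigma : E -> E),
          [/\ #|H| = 2%N,
              semidirect G act,
              forall a b : F, sigma (a%:A + b *: theta) = a%:A - b *: theta
            & forall (h : H) (u : unitsG E), h != 1%g -> val (act h u) = sigma (val u)]).
Proof.
move=> G; have [i iE] := unit_aut_ex irr Egen thetaE.
have i_inj : injective i.
  move=> u v uv; apply/val_inj.
  have [[a b] uE] := quad_ex Egen thetaE (val u).
  have [[c d] vE] := quad_ex Egen thetaE (val v).
  have := iE _ _ _ uE; rewrite uv (iE _ _ _ vE) => /matC_inj cdE.
  by rewrite uE vE; case: cdE => /= -> ->.
have i_matC a b (f : G) : (a, b) != (0, 0) -> val (Xi f) = matC beta gamma a b ->
    exists u, f = i u.
  move=> ab0 fE; exists (Unit_of (quad_unit irr thetaE ab0)).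
  by apply/Xi_inj/val_inj; rewrite fE (iE _ a b).
split=> [g0F2|F2 g0].
  have Xi_matC (f : G) :
      exists a b : F, (a, b) != (0, 0) /\ val (Xi f) = matC beta gamma a b.
    have [a [b [ab0 fE]]] := aut_mx irr f; exists a, b; split=> //.
    case: fE => // -[g0 ->]; apply: matC'_char2 => //.
    by case: g0F2 => //; rewrite g0 eqxx.
  split=> [M|].
    split=> [[f ->]|[a [b [ab0 ->]]]]; first exact: Xi_matC.
    by have [f <-] := matC_aut irr ab0; exists f.
  apply: (bijective_group_isom (f := i)); apply: inj_surj_bij => // f.
  by have [a [b [ab0 fE]]] := Xi_matC f; exact: i_matC fE.
split=> [M|].
  split=> [[f ->]|[a [b [ab0 [->|->]]]]].
  - have [a [b [ab0 fE]]] := aut_mx irr f; exists a, b; split=> //.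
    by case: fE => [|[]]; [left|right].
  - by have [f <-] := matC_aut irr ab0; exists f.
  - by have [f <-] := matC'_aut irr g0 ab0; exists f.
have [sigma sigmaE] := quad_conj_ex irr Egen thetaE.
have sigma_unit (u : unitsG E) : sigma (val u) \is a GRing.unit.
  have [[a b] uE] := quad_ex Egen thetaE (val u).
  rewrite uE sigmaE -scaleNr; apply: (quad_unit irr thetaE).
  apply: contraTneq (valP u) => -[a0 /eqP]; rewrite oppr_eq0 => /eqP b0.
  by rewrite uE /= a0 b0 !scale0r addr0 unitr0.
(* The complement is generated by the involution [s] with matrix [C' 1 0]. *)
have [|s sE] := matC'_aut irr g0 (a := 1) (b := 0).
  by apply/eqP => -[/eqP]; rewrite oner_eq0.
have ss1 : (s * s = 1)%g.
  apply/Xi_inj/val_inj; rewrite /= Xi_mxM Xi_mx1.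
  by move: sE => /= ->; exact: (matC'10_sqr irr).
(* The upper left entry is -1 for [s] and 1 on the image of [i]; these differ as the characteristic
   is not 2. *)
have s_notin n : s <> i n.
  move=> sn; have [[a b] nE] := quad_ex Egen thetaE (val n).
  have := iE _ _ _ nE; rewrite -sn sE => /matrixP/(_ 0 0); rewrite !mxE /= => N11.
  by case/negP: F2; rewrite inE /= mulr2n -{1}N11 addNr.
have [j jE] := involution_morph ss1.
pose act (h : 'I_2) u := if h == 0 then u else Unit_of (sigma_unit u).
have i_act h n : (j h * i n * (j h)^-1)%g = i (act h n).
  rewrite jE /act; case: eqP => _; first by rewrite mul1g invg1 mulg1.
  have [[a b] nE] := quad_ex Egen thetaE (val n).
  have -> : (s^-1 = s)%g by apply: (mulgI s); rewrite mulgV ss1.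
  apply/Xi_inj/val_inj; rewrite (iE _ a (- b)).
    have := iE _ _ _ nE; move: sE; rewrite /= !Xi_mxM => -> ->.
    exact: (matC'10_conj irr).
  by rewrite /= nE sigmaE scaleNr.
have i_j f : exists n h, f = (i n * j h)%g.
  have [a [b [ab0 [fE|[_ fE]]]]] := aut_mx irr f.
    have [n ->] := i_matC _ _ _ ab0 fE.
    by exists n, 0; rewrite jE eqxx mulg1.
  (* The factorisation [C' a b = C a b *m C' 1 0] writes [f] as [g * s] with [g] in the image of
     [i]. *)
  have [g gE] := matC_aut irr ab0; have [n gn] := i_matC _ _ _ ab0 gE.
  exists n, 1; rewrite jE /= -gn; apply/Xi_inj/val_inj.
  by rewrite fE (matC'_mul irr _ _ g0) -gE -sE /= Xi_mxM.
exists 'I_2, act, sigma; split=> //; first by rewrite card_ord.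
- exists i, j; split=> //.
  + move=> [[|[|//]] h2] [[|[|//]] k2]; rewrite !jE /= => E1.
    * exact: val_inj.
    * by case: (s_notin 1%g); rewrite group_morph1.
    * by case: (s_notin 1%g); rewrite group_morph1.
    * exact: val_inj.
  (* Normality: for [g = i m * j h], first [j h] acts through [act], then [m] conjugates inside the
     units. *)
  + move=> g n; have [m [h ->]] := i_j g; exists (m * act h n * m^-1)%g.
    by rewrite !gmulfM group_morphV -i_act invgM !mulgA.
  + move=> n h; rewrite jE; case: eqP => // _ sn.
    by case: (s_notin n).
- by move=> h u; rewrite /act; case: eqP.
Qed.
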